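(* Let $M''$ be the composition of signals $M=(M;X,Y,\Sigma=A\sqcup B;\partial X,\partial Y)$ and $M'=(M';X',Y',\Sigma'=A'\sqcup B';\partial X',\partial Y')$. Then $$E(M'')\le E(M)+E(M')$$ and $$E(F(M''))\ge E(F(M)).$$
   Context: Signals. Let $k\ge 0$ be an integer. Let $X_1,X_2$ be disjoint nonempty closed oriented $k$-dimensional manifolds and $(X;X_1,X_2)$ a $(k+1)$-dimensional oriented cobordism, i.e. $X$ is a compact oriented $(k+1)$-dimensional manifold with $\partial X=X_1\sqcup X_2$. Similarly let $Y_1,Y_2$ be disjoint nonempty closed oriented $k$-dimensional manifolds and $(Y;Y_1,Y_2)$ a $(k+1)$-dimensional oriented cobordism, so $\partial Y=Y_1\sqcup Y_2$. Let $(M;X,Y,\Sigma;\partial X,\partial Y)$ be a $(k+2)$-dimensional relative cobordism (a cobordism between manifolds with nonempty boundary): $M$ is a compact oriented $(k+2)$-dimensional smooth manifold with corners, $(\Sigma;\partial X,\partial Y)$ is a $(k+1)$-dimensional cobordism, $\Sigma\neq\emptyset$, $X\cap Y=\emptyset$, $\Sigma\cap X=\partial X$, $\Sigma\cap Y=\partial Y$, and $\partial M=X\cup\Sigma\cup Y$. Assume moreover $\Sigma=A\sqcup B$, where $(A;X_1,Y_1)$ and $(B;X_2,Y_2)$ are $(k+1)$-dimensional cobordisms. Let $(\tilde M,\tilde g)$ be a Riemannian manifold with $M\subset\tilde M$ an embedded submanifold via the inclusion, and let $M$ carry the Riemannian metric $g$ induced by $\tilde g$. Such an $M$ (with metric $g$)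 is called a signal. Composition. Let $M=(M;X,Y,\Sigma=A\sqcup B;\partial X,\partial Y)$ and $M'=(M';X',Y',\Sigma'=A'\sqcup B';\partial X',\partial Y')$ be two signals such that $Y=X'$ and $M\cap M'=X'$. Their composition is the signal $M''=(M'';X,Y',\Sigma'';\partial X,\partial Y')$ where $M''=M\cup M'$, $A''=A\cup A'$, $B''=B\cup B'$, $\Sigma''=\Sigma\cup\Sigma'=A''\sqcup B''$; it is assumed that $A''\cap B''=\emptyset$. The signal $M''$ is an embedded submanifold of a Riemannian manifold $(\tilde M,\tilde g)$; $g$ denotes the metric induced on $M''$, and $M$, $M'$ carry the metric induced by $g$. Energy. Let $dV_g$ be the volume form of $g$, $\rho_g$ the Riemannian distance of $g$ (on $M''$), and $\rho_g(x,S)$ the distance from $x$ to a set $S$. The energies of the signals are $$E(M)=\int_M\rho_g(x,A)\,dV_g(x),\quad E(M')=\int_{M'}\rho_g(x,A')\,dV_g(x),\quad E(M'')=\int_{M''}\rho_g(x,A'')\,dV_g(x).$$ The Fourier transform $F$ of a signal $M$ is the map of cobordisms of manifolds with boundary $(M;X,Y,\Sigma;\partial X,\partial Y)\to(M;A,B,W;\partial X,\partial Y)$, $W=X\sqcup Y$, induced by the identity map of $M$; the energies of the Fourier transforms are $$E(F(M))=\int_M\rho_g(x,X)\,dV_g(x),\quad E(F(M''))=\int_{M''}\rho_g(x,X)\,dV_g(x).$$ *)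

(* Defs.v *)
From HB Require Import structures.
From mathcomp Require Import all_boot all_order all_algebra.
From mathcomp Require Import all_classical all_reals all_analysis.
Set Implicit Arguments.
Unset Strict Implicit.
Unset Printing Implicit Defensive.
Import Order.TTheory GRing.Theory Num.Theory.
Import numFieldNormedType.Exports.
Local Open Scope classical_set_scope.
Local Open Scope ring_scope.

Section SmoothMaps.
Context {R : realType} {n : nat} {V : normedModType R}.

Definition iter_derive (vs : seq 'rV[R]_n) (f : 'rV[R]_n -> V) :
    'rV[R]_n -> V :=
  foldr (fun v h x => 'D_v h x) f vs.

(* C^infinity on an open set U: all iterated directional derivatives exist and
   are continuous on U. *)
Definition smooth_on (U : set 'rV[R]_n) (f : 'rV[R]_n -> V) : Prop :=
  forall vs x, U x ->
    {for x, continuous (iter_derive vs f)} /\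
    forall v, derivable (iter_derive vs f) x v.

End SmoothMaps.

(* A homeomorphism from the open set [dom] onto an open subset of R^n; [coord]
   and [icoord] are unconstrained outside [dom] and [coord @` dom]. *)
Record chart (R : realType) (n : nat) (T : topologicalType) := Chart {
  dom : set T;
  coord :> T -> 'rV[R]_n;
  icoord : 'rV[R]_n -> T;
  open_dom : open dom;
  open_coord : open (coord @` dom);
  coordK : forall p, dom p -> icoord (coord p) = p;
  coord_continuous : forall p, dom p -> {for p, continuous coord};
  icoord_continuous :
    forall x, (coord @` dom) x -> {for x, continuous icoord} }.

Definition transition {R : realType} {n : nat} {T : topologicalType}
  (phi psi : chart R n T) : 'rV[R]_n -> 'rV[R]_n := psi \o icoord phi.

(* Row-vector convention: if v is the coordinate row of a tangent vector at p in
   the chart phi, then v *m transition_jacobian phi psi p is its coordinate row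
   in the chart psi. *)
Definition transition_jacobian {R : realType} {n : nat} {T : topologicalType}
  (phi psi : chart R n T) (p : T) : 'M[R]_n :=
  jacobian (transition phi psi) (phi p).

Definition smooth_transition {R : realType} {n : nat} {T : topologicalType}
  (phi psi : chart R n T) : Prop :=
  smooth_on (phi @` (dom phi `&` dom psi)) (transition phi psi).

Record manifold (R : realType) (n : nat) (T : topologicalType) := Manifold {
  manifold_hausdorff : hausdorff_space T;
  manifold_second_countable : @second_countable T;
  atlas : set (chart R n T);
  chart_at : T -> chart R n T;
  chart_at_atlas : forall p, atlas (chart_at p);
  chart_at_dom : forall p, dom (chart_at p) p;
  atlas_smooth :
    forall phi psi, atlas phi -> atlas psi -> smooth_transition phi psi }.

(* The maximal atlas generated by [atlas N]. *)
Definition admissible {R : realType} {n : nat} {T : topologicalType}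
  (N : manifold R n T) : set (chart R n T) :=
  [set phi | forall psi, atlas N psi ->
     smooth_transition phi psi /\ smooth_transition psi phi].

(* [metric phi p] is the matrix (g_ij(p)) in the coordinates of phi; its values
   are only meaningful for admissible phi and p in [dom phi]. *)
Record riemannian_metric (R : realType) (n : nat) (T : topologicalType)
    (N : manifold R n T) := RiemannianMetric {
  metric :> chart R n T -> T -> 'M[R]_n;
  metric_sym : forall phi p, admissible N phi -> dom phi p ->
    (metric phi p)^T = metric phi p;
  metric_pos : forall phi p (v : 'rV[R]_n), admissible N phi -> dom phi p ->
    v != 0 -> 0 < (v *m metric phi p *m v^T) 0 0;
  metric_smooth : forall phi, admissible N phi ->
    smooth_on (phi @` dom phi) (metric phi \o icoord phi);
  metric_transition : forall phi psi p, admissible N phi -> admissible N psi ->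
    dom phi p -> dom psi p ->
    metric phi p = transition_jacobian phi psi p *m metric psi p
                     *m (transition_jacobian phi psi p)^T }.

Section Submanifolds.
Context {R : realType} {n : nat} {T : topologicalType} (N : manifold R n T).

(* In the chart phi, S is the part of phi's range lying in
   [0,+oo[^j x R^(m-j) x {0}^(n-m). *)
Definition slice_chart (m : nat) (S : set T) (j : nat) (phi : chart R n T) :
    Prop :=
  [/\ admissible N phi, (j <= m <= n)%N &
      forall p, dom phi p ->
        S p <-> forall i : 'I_n,
          ((i < j)%N -> 0 <= phi p 0 i) /\ ((m <= i)%N -> phi p 0 i = 0)].

Definition slice_chart_at (m : nat) (S : set T) (phi : chart R n T) (p : T) :
    Prop :=
  (exists j, slice_chart m S j phi) /\ dom phi p.

(* p lies on a corner of S of codimension exactly j: j = 0 at interior points,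
   j = 1 at smooth boundary points. *)
Definition has_depth (m : nat) (S : set T) (j : nat) (p : T) : Prop :=
  S p /\ exists phi, [/\ slice_chart m S j phi, dom phi p &
                         forall i : 'I_n, (i < j)%N -> phi p 0 i = 0].

Definition manifold_with_corners (m : nat) (S : set T) : Prop :=
  forall p, S p -> exists j, has_depth m S j p.

Definition manifold_with_boundary (m : nat) (S : set T) : Prop :=
  forall p, S p -> exists2 j, (j <= 1)%N & has_depth m S j p.

Definition boundary (m : nat) (S : set T) : set T :=
  [set p | exists2 j, (0 < j)%N & has_depth m S j p].

Definition closed_manifold (m : nat) (S : set T) : Prop :=
  [/\ compact S, manifold_with_boundary m S & boundary m S = set0].

(* W is an (m+1)-dimensional cobordism between V0 and V1. *)
Definition cobordism (m : nat) (W V0 V1 : set T) : Prop :=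
  [/\ compact W /\ manifold_with_boundary m.+1 W,
      closed_manifold m V0, closed_manifold m V1,
      V0 `&` V1 = set0 & boundary m.+1 W = V0 `|` V1].

(* An m-dimensional submanifold together with a sign for every slice chart at
   every point, [true] meaning that the first m coordinate vectors of the chart
   form a positive frame. Signs, rather than an oriented atlas, also give the
   orientations of points (m = 0) and of half-open intervals. *)
Record omanifold := OManifold {
  carrier :> set T;
  orient : chart R n T -> T -> bool }.

(* The m x m block of the Jacobian for the first m coordinates, i.e. the change
   of coordinates on the tangent space of the submanifold. *)
Definition slice_jacobian (m : nat) (phi psi : chart R n T) (p : T) :
    'M[R]_m :=
  (pid_mx m : 'M[R]_(m, n)) *m transition_jacobian phi psi p
    *m (pid_mx m : 'M[R]_(m, n))^T.

(* The orientations of S and S' agree where S and S' (of the same dimension m,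
   one being included in the other) overlap. *)
Definition orient_agree (m : nat) (S S' : omanifold) : Prop :=
  forall phi psi p, (S `&` S') p ->
    slice_chart_at m S phi p -> slice_chart_at m S' psi p ->
    orient S' psi p =
      addb (orient S phi p) (\det (slice_jacobian m phi psi p) < 0).

Definition oriented (m : nat) (S : omanifold) : Prop :=
  orient_agree m S S /\
  forall phi p, carrier S p -> slice_chart_at m S phi p ->
    \forall q \near p, carrier S q -> orient S phi q = orient S phi p.

Definition oriented_eq (m : nat) (S S' : omanifold) : Prop :=
  carrier S = carrier S' /\ orient_agree m S S'.

Definition oriented_union (m : nat) (S S' S'' : omanifold) : Prop :=
  [/\ carrier S'' = carrier S `|` carrier S', orient_agree m S S'' &
      orient_agree m S' S''].

Definition oriented_cobordism (m : nat) (W V0 V1 : omanifold) : Prop :=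
  [/\ cobordism m W V0 V1, oriented m.+1 W, oriented m V0 & oriented m V1].

Record signal_data := SignalData {
  sM : omanifold;
  sX : omanifold; sX1 : omanifold; sX2 : omanifold;
  sY : omanifold; sY1 : omanifold; sY2 : omanifold;
  sA : omanifold; sB : omanifold }.

Definition sSigma (s : signal_data) : set T := sA s `|` sB s.

Record is_signal (k : nat) (s : signal_data) : Prop := IsSignal {
  signal_X : oriented_cobordism k (sX s) (sX1 s) (sX2 s);
  signal_Y : oriented_cobordism k (sY s) (sY1 s) (sY2 s);
  signal_X_nonempty : sX1 s !=set0 /\ sX2 s !=set0;
  signal_Y_nonempty : sY1 s !=set0 /\ sY2 s !=set0;
  signal_A : oriented_cobordism k (sA s) (sX1 s) (sY1 s);
  signal_B : oriented_cobordism k (sB s) (sX2 s) (sY2 s);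
  signal_AB : sA s `&` sB s = set0;
  signal_Sigma : cobordism k (sSigma s)
    (boundary k.+1 (sX s)) (boundary k.+1 (sY s));
  signal_Sigma_nonempty : sSigma s !=set0;
  signal_XY : sX s `&` sY s = set0;
  signal_SigmaX : sSigma s `&` sX s = boundary k.+1 (sX s);
  signal_SigmaY : sSigma s `&` sY s = boundary k.+1 (sY s);
  signal_M_compact : compact (sM s);
  signal_M_corners : manifold_with_corners k.+2 (sM s);
  signal_M_oriented : oriented k.+2 (sM s);
  signal_M_boundary : boundary k.+2 (sM s) = sX s `|` sSigma s `|` sY s }.

(* The Fourier transform exchanges (X, Y) with (A, B). Accordingly the closed
   manifolds bounding them are regrouped from (X1, X2), (Y1, Y2) into
   (X1, Y1), (X2, Y2). *)
Definition fourier (s : signal_data) : signal_data :=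
  {| sM := sM s;
     sX := sA s; sX1 := sX1 s; sX2 := sY1 s;
     sY := sB s; sY1 := sX2 s; sY2 := sY2 s;
     sA := sX s; sB := sY s |}.

Record is_composition (k : nat) (s s' s'' : signal_data) : Prop :=
    IsComposition {
  comp_signal1 : is_signal k s;
  comp_signal2 : is_signal k s';
  comp_signal : is_signal k s'';
  comp_YX' : [/\ oriented_eq k.+1 (sY s) (sX s'),
                 oriented_eq k (sY1 s) (sX1 s') &
                 oriented_eq k (sY2 s) (sX2 s')];
  comp_MM' : sM s `&` sM s' = sX s';
  comp_X : [/\ oriented_eq k.+1 (sX s) (sX s''),
               oriented_eq k (sX1 s) (sX1 s'') &
               oriented_eq k (sX2 s) (sX2 s'')];
  comp_Y : [/\ oriented_eq k.+1 (sY s') (sY s''),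
               oriented_eq k (sY1 s') (sY1 s'') &
               oriented_eq k (sY2 s') (sY2 s'')];
  comp_M : oriented_union k.+2 (sM s) (sM s') (sM s'');
  comp_A : oriented_union k.+1 (sA s) (sA s') (sA s'');
  comp_B : oriented_union k.+1 (sB s) (sB s') (sB s'') }.

Definition velocity (gamma : R -> T) (t : R) : 'rV[R]_n :=
  derive1 (chart_at N (gamma t) \o gamma) t.

(* Piecewise C^1 curves on [0, 1], s being the list of break points. The
   one-sided limits of the derivative express that each piece is C^1 up to its
   end points. *)
Definition piecewise_C1 (gamma : R -> T) : Prop :=
  {within `[0, 1], continuous gamma} /\
  exists s : seq R, forall t, 0 <= t <= 1 ->
    let u : R -> 'rV[R]_n := chart_at N (gamma t) \o gamma in
    [/\ t \notin s -> 0 < t < 1 ->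
          (\forall x \near t, derivable u x 1) /\ {for t, continuous (derive1 u)},
        t < 1 -> cvg (derive1 u x @[x --> t^'+]) &
        0 < t -> cvg (derive1 u x @[x --> t^'-])].

Variable g : riemannian_metric N.

Definition speed (gamma : R -> T) (t : R) : R :=
  let v := velocity gamma t in
  Num.sqrt ((v *m g (chart_at N (gamma t)) (gamma t) *m v^T) 0 0).

(* For a curve inside a submanifold this is its length for the induced metric;
   the value of [speed] at the break points is irrelevant. *)
Definition curve_length (gamma : R -> T) : \bar R :=
  (\int[lebesgue_measure]_(t in `[0%R, 1%R]) (speed gamma t)%:E)%E.

(* Distance of the metric induced by g on the submanifold S; +oo if x and y are
   in different components of S. *)
Definition riemannian_dist (S : set T) (x y : T) : \bar R :=
  ereal_inf [set curve_length gamma | gamma in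
    [set gamma | [/\ piecewise_C1 gamma, forall t, 0 <= t <= 1 -> S (gamma t),
                     gamma 0 = x & gamma 1 = y]]].

Definition dist_to_set (rho : T -> T -> \bar R) (x : T) (A : set T) : \bar R :=
  ereal_inf [set rho x a | a in A].

End Submanifolds.

(* Lebesgue integral over R^m, as an iterated integral. *)
Fixpoint lebesgue_integral_rV {R : realType} (m : nat) :
    ('rV[R]_m -> \bar R) -> \bar R :=
  match m with
  | 0 => fun f => f 0
  | m'.+1 => fun f =>
      (\int[lebesgue_measure]_x
         lebesgue_integral_rV (fun v : 'rV[R]_m' => f (row_mx x%:M v)))%E
  end.

Notation borel T := (g_sigma_algebraType (@open T)).

Section Volume.
Context {R : realType} {n : nat} {T : ptopologicalType} (N : manifold R n T).
Variable g : riemannian_metric N.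

(* Matrix, in the first m coordinates of a slice chart, of the metric induced by
   g on an m-dimensional submanifold. *)
Definition induced_metric (m : nat) (phi : chart R n T) (p : T) : 'M[R]_m :=
  (pid_mx m : 'M[R]_(m, n)) *m g phi p *m (pid_mx m : 'M[R]_(m, n))^T.

(* mu is the measure of the volume form of the metric induced by g on the
   m-dimensional submanifold S: mu is concentrated on S, and is given by the
   density sqrt(det(g_ij)) in every slice chart. *)
Definition riemannian_volume (m : nat) (S : set T)
    (mu : {measure set (borel T) -> \bar R}) : Prop :=
  mu (~` S) = 0%E /\
  forall j phi, slice_chart N m S j phi ->
  forall E : set (borel T), measurable E -> E `<=` dom phi `&` S ->
    mu E = lebesgue_integral_rV (fun x : 'rV[R]_m =>
      let y : 'rV[R]_n := x *m pid_mx m in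
      let p := icoord phi y in
      if `[< (phi @` E) y >]
      then (Num.sqrt (\det (induced_metric m phi p)))%:E else 0%E).

Definition energy (mu : {measure set (borel T) -> \bar R})
    (rho : T -> T -> \bar R) (s : @signal_data R n T) : \bar R :=
  (\int[mu]_(x in sM s) dist_to_set rho x (sA s))%E.

End Volume.

(* Main.v *)
Require Import Defs.
From mathcomp Require Import all_boot all_order all_algebra.
From mathcomp Require Import all_classical all_reals all_analysis.
Local Open Scope classical_set_scope.
Local Open Scope ring_scope.

(** Both inequalities are comparisons of integrands.  By the definition of the
    composition, A'' is the union of A and A', so the distance to A'' is at most
    the distance to A and at most the distance to A'; splitting the integral over
    M'', the union of M and M', into the parts over M and M' gives the first
    inequality ([ge0_integral_setU_le]).  For the Fourier transforms both
    integrands are the distance to X, which is nonnegative ([dist_to_set_ge0])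
    and is integrated over M on one side and over the larger M'' on the other
    ([ge0_le_integral_subset]).

    The integral of a nonnegative function is the supremum of the integrals of
    the simple functions below it.  This supremum is monotone, and subadditive
    over measurable sets, for arbitrary nonnegative integrands, so the distance
    functions are compared directly through the simple functions below them.
    The domains M and M' are Borel sets because they are compact in a Hausdorff
    space ([compact_measurable_borel]). *)

Section LowerIntegral.
Import Order.TTheory GRing.Theory Num.Theory HBNNSimple.
Local Open Scope ereal_scope.
Context d (T : measurableType d) (R : realType).
Variable mu : {measure set T -> \bar R}.

(** Every simple function below [f] on [A] and zero elsewhere also competes in
    the supremum that defines the integral of [g] over [B], because [g] is
    nonnegative on the rest of [B]. *)
Lemma ge0_le_integral_subset (A B : set T) (f g : T -> \bar R) :
  A `<=` B -> (forall x, A x -> 0 <= f x) -> (forall x, B x -> 0 <= g x) ->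
  (forall x, A x -> f x <= g x) ->
  \int[mu]_(x in A) f x <= \int[mu]_(x in B) g x.
Proof.
move=> AB f0 g0 fg; rewrite !ge0_integralE//.
apply: ge_ereal_sup => _ [h /= hf <-]; apply: ereal_sup_ubound.
exists h => // x; apply: le_trans (hf x) _.
rewrite !patchE; case: ifPn => [/set_mem Ax|_].
  by rewrite mem_set ?fg//; exact: AB.
by case: ifPn => // /set_mem /g0.
Qed.

(** A simple function [h] vanishing outside [A `|` B] is bounded by the sum of
    its restrictions to [A] and to [B]; these are simple because the two sets
    are measurable, and each competes in the corresponding supremum.  The overlap
    [A `&` B] is counted twice, hence an inequality. *)
Lemma ge0_integral_setU_le (A B : set T) (f : T -> \bar R) :
  measurable A -> measurable B -> (forall x, (A `|` B) x -> 0 <= f x) ->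
  \int[mu]_(x in A `|` B) f x <= \int[mu]_(x in A) f x + \int[mu]_(x in B) f x.
Proof.
move=> mA mB f0.
have restr_le (C : set T) (mC : measurable C) (h : {nnsfun T >-> R}) :
    C `<=` A `|` B -> (forall x, (h x)%:E <= (f \_ (A `|` B)) x) ->
    sintegral mu (proj_nnsfun h mC) <= \int[mu]_(x in C) f x.
  move=> CAB hf; rewrite ge0_integralE; last by move=> x /CAB /f0.
  apply: ereal_sup_ubound; exists (proj_nnsfun h mC) => // x.
  rewrite -mrestrict !patchE; case: ifPn => // /set_mem Cx.
  by have := hf x; rewrite patchE mem_set//; exact: CAB.
rewrite ge0_integralE//; apply: ge_ereal_sup => _ [h /= hf <-].
apply: le_trans (leeD (restr_le A mA h _ hf) (restr_le B mB h _ hf));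
  [|exact: subsetUl|exact: subsetUr].
rewrite -sintegralD; apply: le_sintegral => x /=.
rewrite !measurable_realfun.mindicE; have := hf x; rewrite patchE in_setU.
by case: (x \in A); case: (x \in B);
  rewrite /= ?mulr1 ?mulr0 ?addr0 ?add0r ?lee_fin ?lerDl => // _; exact: fun_ge0.
Qed.

End LowerIntegral.

Section Distance.
Local Open Scope ereal_scope.

Lemma le_dist_to_set (R : realType) (T : topologicalType)
    (rho : T -> T -> \bar R) (x : T) (A B : set T) :
  A `<=` B -> dist_to_set rho x B <= dist_to_set rho x A.
Proof. by move=> AB; apply: ereal_inf_le_tmp; apply: image_subset. Qed.

(** The distance is an infimum of curve lengths, which are integrals of
    nonnegative speeds; where no curve exists it is [+oo]. *)
Lemma dist_to_set_ge0 (R : realType) (n : nat) (T : topologicalType)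
    (N : manifold R n T) (g : riemannian_metric N) (S A : set T) (x : T) :
  0 <= dist_to_set (riemannian_dist g S) x A.
Proof.
apply: le_ereal_inf_tmp => _ [a _ <-]; apply: le_ereal_inf_tmp => _ [c _ <-].
by apply: integral_ge0 => t _; rewrite lee_fin Num.Theory.sqrtr_ge0.
Qed.

End Distance.

Lemma compact_measurable_borel (T : ptopologicalType) (A : set T) :
  hausdorff_space T -> compact A -> measurable (A : set (borel T)).
Proof.
move=> hT cA; rewrite -[A]setCK; apply: measurableC; apply: sub_sigma_algebra.
by rewrite /= openC; exact: compact_closed.
Qed.

Theorem theorem2p8 (R : realType) (k n : nat) (T : ptopologicalType)
    (N : manifold R n T) (g : riemannian_metric N)
    (s s' s'' : @signal_data R n T)
    (vol : {measure set (borel T) -> \bar R}) :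
  is_composition N k s s' s'' ->
  riemannian_volume g k.+2 (sM s'') vol ->
  let rho := riemannian_dist g (sM s'') in
  (energy vol rho s'' <= energy vol rho s + energy vol rho s')%E /\
  (energy vol rho (fourier s) <= energy vol rho (fourier s''))%E.
Proof.
move=> comp _ rho.
have [EM _ _] := comp_M comp.
have [EA _ _] := comp_A comp.
have [[EX _] _ _] := comp_X comp.
have d0 (S : set T) (x : T) : (0 <= dist_to_set rho x S)%E.
  exact: dist_to_set_ge0.
have mM (r : signal_data) : is_signal N k r ->
    measurable (carrier (sM r) : set (borel T)).
  move=> sr; apply: compact_measurable_borel; first exact: manifold_hausdorff N.
  exact: signal_M_compact sr.
rewrite /energy /= EM EA EX; split; last first.
  by apply: ge0_le_integral_subset => // x Mx; left.
apply: Order.POrderTheory.le_trans.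
  apply: ge0_integral_setU_le => //; first exact: mM (comp_signal1 comp).
  exact: mM (comp_signal2 comp).
apply: leeD; apply: ge0_le_integral_subset => // x _; apply: le_dist_to_set.
- exact: subsetUl.
- exact: subsetUr.
Qed.
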